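(* Consider $\mathcal{H}$ and $\mathcal{H}'$ two Hilbert spaces, and $\mathcal{Y} \subset \mathcal{H}'$ a non-empty set. Let $a: \mathcal{Y} \to \mathbb{R} \cup \{+\infty\}$, $b: \mathcal{H} \to \mathbb{R} \cup \{+\infty\}$, $A: \mathcal{Y} \to \mathcal{H}$ and $B: \mathcal{H} \to \mathcal{H}'$ be arbitrary functions. Consider $f: \mathcal{Y} \to \mathcal{H}$ and denote by $\mathrm{Im}(f)$ the image of $\mathcal{Y}$ under $f$. (a) Let $D(x,y) := a(y)-\langle x,A(y)\rangle+b(x)$. The following properties are equivalent: (i) there is $\varphi: \mathcal{H} \to \mathbb{R} \cup \{+\infty\}$ such that $f(y) \in \arg\min_{x \in \mathcal{H}} \{D(x,y)+\varphi(x)\}$ for each $y \in \mathcal{Y}$; (ii) there is a convex lower semicontinuous $g: \mathcal{H} \to \mathbb{R} \cup \{+\infty\}$ such that $A(f^{-1}(x))\subset \partial g(x)$ for each $x \in \mathrm{Im}(f)$. When they hold, $\varphi$ (resp. $g$) can be chosen given $g$ (resp. $\varphi$) so that $g(x)+\chi_{\mathrm{Im}(f)}(x) = b(x)+\varphi(x)$. (b) Let $\varphi$ and $g$ satisfy (a)(i) and (a)(ii), respectively, and let $\mathcal{C} \subset \mathrm{Im}(f)$ be polygonally connected. Then there is $K \in \mathbb{R}$ such that $g(x) = b(x)+\varphi(x) + K$ for all $x \in \mathcal{C}$. (c) Let $\widetilde D(x,y) := a(y)-\langle B(x),y\rangle+b(x)$. The following properties are equivalent: (i) there is $\varphi: \mathcal{H}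 \to \mathbb{R} \cup \{+\infty\}$ such that $f(y) \in \arg\min_{x \in \mathcal{H}} \{\widetilde D(x,y)+\varphi(x)\}$ for each $y \in \mathcal{Y}$; (ii) there is a convex lower semicontinuous $\psi: \mathcal{H}' \to \mathbb{R} \cup \{+\infty\}$ such that $B(f(y))\in \partial \psi(y)$ for each $y \in \mathcal{Y}$. $\varphi$ (resp. $\psi$) can be chosen given $\psi$ (resp. $\varphi$) so that $\psi(y) = \langle B(f(y)),y\rangle-b(f(y))-\varphi(f(y))$ on $\mathcal{Y}$. (d) Let $\varphi$ and $\psi$ satisfy (c)(i) and (c)(ii), respectively, and let $\mathcal{C}' \subset \mathcal{Y}$ be polygonally connected. Then there is $K' \in \mathbb{R}$ such that $\psi(y) = \langle B(f(y)),y\rangle-b(f(y))-\varphi(f(y)) + K'$ for all $y \in \mathcal{C}'$.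
   Context: The same notation $\langle\cdot,\cdot\rangle$ is used for the inner products of $\mathcal{H}$ and $\mathcal{H}'$. $f^{-1}(x)=\{y\in\mathcal{Y}: f(y)=x\}$ and $A(f^{-1}(x))=\{A(y):y\in f^{-1}(x)\}$. $\chi_{\mathcal S}(x)=0$ if $x\in\mathcal S$ and $+\infty$ otherwise. $\arg\min$ denotes the set of global minimizers. For a function $\theta$ on a Hilbert space with values in $\mathbb{R}\cup\{+\infty\}$, the subdifferential $\partial\theta(x)$ is the set of all $u$ such that $\theta(x')\geq\theta(x)+\langle u,x'-x\rangle$ for all $x'$, with $\partial\theta(x)=\varnothing$ when $\theta(x)=+\infty$. A non-empty subset $\mathcal{C}$ of a Hilbert space is polygonally connected if any two points $x,x'\in\mathcal{C}$ can be joined by a polygonal path in $\mathcal{C}$, i.e. there are $x_0=x,x_1,\dots,x_n=x'$ with each segment $[x_{i-1},x_i]=\{t x_{i-1}+(1-t)x_i: t\in[0,1]\}\subset\mathcal{C}$.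
   Formalization: Minimizers must have finite value; the equivalences in (a), (c) assume D(f(y),y) < +∞ (resp. D̃) for y in Y, as (ii)⇒(i) fails otherwise; when g is chosen given φ, g = b+φ is claimed only on Im(f), since off Im(f) the stated identity can fail. *)

(* Defs.v *)
From mathcomp Require Export all_boot all_order all_algebra.
From mathcomp Require Export all_classical all_reals all_analysis.
Export Order.TTheory GRing.Theory Num.Theory.
Export numFieldNormedType.Exports.

Set Implicit Arguments.
Unset Strict Implicit.
Unset Printing Implicit Defensive.

Local Open Scope classical_set_scope.
Local Open Scope ring_scope.
Local Open Scope ereal_scope.

(* A real Hilbert space is a complete normed module together with a positive
   definite symmetric bilinear form that induces its norm. *)
Definition induces_norm (R : realType) (H : completeNormedModType R)
    (ip : {dot H for @idfun R}) : Prop :=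
  forall x : H, ip x x = (`|x| ^+ 2)%R.

(* Functions with values in R ∪ {+oo} are \bar R-valued functions that avoid
   -oo. *)
Definition no_ninfty (R : realType) (T : Type) (S : set T) (h : T -> \bar R) :
    Prop :=
  forall x, S x -> -oo < h x.

(* The function constantly equal to +oo has no minimizer. *)
Definition argmin (R : realType) (T : Type) (F : T -> \bar R) : set T :=
  [set x | F x < +oo /\ forall x', F x <= F x'].

Definition chi (R : realType) (T : Type) (S : set T) (x : T) : \bar R :=
  if x \in S then 0 else +oo.
Arguments chi {R T} S x.

Definition convex_ereal (R : realType) (V : lmodType R) (h : V -> \bar R) :
    Prop :=
  forall (x y : V) (t : R), (0 < t < 1)%R ->
    h (t *: x + (1 - t) *: y)%R <= t%:E * h x + (1 - t)%:E * h y.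

Definition convex_lsc (R : realType) (H : completeNormedModType R)
    (h : H -> \bar R) : Prop :=
  [/\ no_ninfty setT h, convex_ereal h & lower_semicontinuous h].

Definition subdiff (R : realType) (H : completeNormedModType R)
    (ip : {dot H for @idfun R}) (h : H -> \bar R) (x : H) : set H :=
  [set u | h x < +oo /\
           forall x', h x' >= h x + (ip u (x' - x)%R)%:E].

Definition segment (R : realType) (V : lmodType R) (x y : V) : set V :=
  [set (t *: x + (1 - t) *: y)%R | t in `[0%R, 1%R]].

Definition polygonally_connected (R : realType) (V : lmodType R) (C : set V) :
    Prop :=
  C !=set0 /\
  forall x x', C x -> C x' ->
    exists (n : nat) (p : nat -> V),
      [/\ p 0%N = x, p n = x' &
          forall i, (i < n)%N -> segment (p i) (p i.+1) `<=` C].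

Definition minimizes_penalized (R : realType) (T U : Type) (Y : set U)
    (D : T -> U -> \bar R) (f : U -> T) (phi : T -> \bar R) : Prop :=
  no_ninfty setT phi /\
  forall y, Y y -> argmin (fun x => D x y + phi x) (f y).

(* Main.v *)
(** The subdifferential inclusions are optimality conditions in disguise: with
    [theta := b + phi], minimality of [f y] says exactly that [theta] lies above
    the affine function of slope [A y] touching it at [f y] (case a), or that
    [y |-> <B (f y), y> - theta (f y)] is on [Y] the conjugate
    [sup_x (<B x, y> - theta x)] (case c).  The required convex lsc function is the
    supremum of the resulting affine functions.  For uniqueness, two functions
    sharing a selection [u] of subgradients satisfy, along a segment with
    direction [v], [|d s - d t| <= (s - t) (m s - m t)], where [d] is their
    difference and [m := <u, v>]; cutting the segment into [n] equal pieces and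
    telescoping bounds [|d 1 - d 0|] by [(m 1 - m 0) / n]. *)
Require Import Defs.
From mathcomp Require Import ring lra.

Set Implicit Arguments.
Unset Strict Implicit.
Unset Printing Implicit Defensive.

Local Open Scope classical_set_scope.
Local Open Scope ring_scope.
Local Open Scope ereal_scope.

(** * One-variable estimate on the unit interval *)

Lemma eq_of_increment_le (R : realType) (d m : R -> R) :
  (forall s t, 0 <= t -> t <= s -> s <= 1 ->
    `|d s - d t| <= (s - t) * (m s - m t))%R ->
  d 1%R = d 0%R.
Proof.
move=> dm.
have part n k : (k <= n.+1)%N ->
    (`|d (k%:R / n.+1%:R) - d 0| <= (m (k%:R / n.+1%:R) - m 0) / n.+1%:R)%R.
  elim: k => [|k IH] kn; first by rewrite mul0r !subrr normr0 mul0r.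
  have n0 : (0 < n.+1%:R :> R)%R by rewrite ltr0n.
  have := dm (k.+1%:R / n.+1%:R)%R (k%:R / n.+1%:R)%R.
  rewrite -mulrBl -natrB// subSnn ler_pM2r ?invr_gt0// ler_nat leqnSn.
  rewrite ler_pdivrMr// mul1r ler_nat kn divr_ge0// => /(_ isT isT isT) step.
  rewrite -(subrKA (d (k%:R / n.+1%:R)%R)).
  apply: le_trans (ler_normD _ _) _; apply: le_trans (lerD step (IH (ltnW kn))) _.
  by rewrite mul1r mulrC -mulrDl subrKA.
apply/eqP/negPn/negP; rewrite -subr_eq0 -normr_gt0 => e0.
(* If [d 1] and [d 0] differed, [part] at the last grid point would bound every [n.+1] by this
   quotient. *)
pose n := Num.bound `|(m 1 - m 0) / `|d 1 - d 0| |%R.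
have := part n n.+1 (leqnn _); rewrite divff ?pnatr_eq0//.
rewrite ler_pdivlMr ?ltr0n// mulrC -ler_pdivlMr// => le_n.
have : ((m 1 - m 0) / `|d 1 - d 0| < n.+1%:R)%R.
  apply: le_lt_trans (ler_norm _) _; apply: lt_trans (archi_boundP (normr_ge0 _)) _.
  by rewrite ltr_nat.
by rewrite ltNge le_n.
Qed.

(** * Inner products, suprema of affine functions, uniqueness along polygonal paths *)

Section InnerProduct.
Context (R : realType) (H : completeNormedModType R).
Variable ip : {dot H for @idfun R}.

Lemma dot_sym x y : ip x y = ip y x.
Proof. by rewrite hermC expr0 mul1r. Qed.

(* The library lemmas state these through the coercion to bilinear forms, whose
   head symbol blocks later rewriting. *)
Lemma dotDr u x y : ip u (x + y)%R = (ip u x + ip u y)%R.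
Proof. exact: linearDr. Qed.

Lemma dotBr u x y : ip u (x - y)%R = (ip u x - ip u y)%R.
Proof. exact: linearBr. Qed.

Lemma dotZr u t x : ip u (t *: x)%R = (t * ip u x)%R.
Proof. exact: (linearZr_LR ip). Qed.

(* Polarization gives continuity without the Cauchy-Schwarz inequality. *)
Lemma dot_continuous (ip_norm : induces_norm ip) u : continuous (ip u).
Proof.
have -> : ip u = (fun x => (`|u + x| ^+ 2 - `|u| ^+ 2 - `|x| ^+ 2) / 2)%R :> (H -> R).
  apply/funext => x; rewrite -!ip_norm dotDr !(dot_sym (u + x)%R) !dotDr (dot_sym x u).
  by field.
move=> x; apply: cvgMl; apply: cvgB; last first.
  by apply: cvgM; apply: cvg_norm; exact: cvg_id.
apply: cvgB; last exact: cvg_cst.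
by apply: cvgM; apply: cvg_norm; apply: cvgD; [exact: cvg_cst | exact: cvg_id
                                            |exact: cvg_cst | exact: cvg_id].
Qed.

(** Slopes and constants are indexed separately from the space, so that one construction serves both
    cases: indices in [Y], with slopes [A y] or [B (f y)]. *)
Definition affine_sup (I : Type) (Y : set I) (u : I -> H) (k : I -> R) (x : H) :=
  ereal_sup [set (ip (u i) x + k i)%:E | i in Y].

Lemma affine_sup_ge I (Y : set I) u k x i : Y i ->
  (ip (u i) x + k i)%:E <= affine_sup Y u k x.
Proof. by move=> Yi; apply: ereal_sup_ubound; exists i. Qed.

Lemma affine_sup_convex_lsc (ip_norm : induces_norm ip) I (Y : set I) u k :
  Y !=set0 -> convex_lsc (affine_sup Y u k).
Proof.
move=> [i0 Yi0]; split.
- by move=> x _; apply: lt_le_trans (affine_sup_ge _ _ _ Yi0); exact: ltNyr.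
- move=> x y t /andP[t0 t1]; apply: ge_ereal_sup => _ [i Yi <-].
  have -> : (ip (u i) (t *: x + (1 - t) *: y) + k i)%:E =
      t%:E * (ip (u i) x + k i)%:E + (1 - t)%:E * (ip (u i) y + k i)%:E.
    rewrite -!EFinM -EFinD dotDr !dotZr; congr EFin.
    by ring.
  by apply: leeD; apply: lee_wpmul2l; rewrite ?affine_sup_ge// lee_fin ?subr_ge0 ltW.
(* A value below the supremum is already exceeded by one affine function, and by continuity this
   persists near [x]. *)
- move=> x r /ereal_sup_gt[_ [i Yi <-]]; rewrite lte_fin => r_lt.
  exists [set z | (r < ip (u i) z + k i)%R]; last first.
    move=> z rz; apply: lt_le_trans (affine_sup_ge _ _ _ Yi).
    by rewrite lte_fin.
  have cont : (fun z => ip (u i) z + k i)%R z @[z --> x] --> (ip (u i) x + k i)%R.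
    by apply: cvgD; [exact: dot_continuous | exact: cvg_cst].
  exact: (cvgr_gt _ cont).
Qed.

(** An affine function that is largest at [x] touches the supremum there and minorizes it
    everywhere, so its slope is a subgradient. *)
Lemma affine_sup_contact I (Y : set I) u k i x : Y i ->
    (forall j, Y j -> ip (u j) x + k j <= ip (u i) x + k i)%R ->
  affine_sup Y u k x = (ip (u i) x + k i)%:E /\
  subdiff ip (affine_sup Y u k) x (u i).
Proof.
move=> Yi max_i.
have eq_x : affine_sup Y u k x = (ip (u i) x + k i)%:E.
  apply/eqP; rewrite eq_le affine_sup_ge// andbT.
  by apply: ge_ereal_sup => _ [j Yj <-]; rewrite lee_fin max_i.
split=> //; rewrite /subdiff/= eq_x ltry; split=> // x'.
rewrite -EFinD dotBr addrAC subrKC; exact: affine_sup_ge.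
Qed.


(** Using the subgradient inequality at both ends of a subsegment squeezes the increments of [G1]
    and of [G2] between the same two bounds, which controls the increment of their difference. *)
Lemma segment_eq_diff (C : set H) (u : H -> H) (G1 G2 : H -> R) x y :
    segment x y `<=` C ->
    (forall z z', C z -> C z' -> (ip (u z) (z' - z) <= G1 z' - G1 z)%R) ->
    (forall z z', C z -> C z' -> (ip (u z) (z' - z) <= G2 z' - G2 z)%R) ->
  (G1 x - G2 x = G1 y - G2 y)%R.
Proof.
move=> sC sub1 sub2.
pose p (t : R) := (t *: x + (1 - t) *: y)%R.
have pC t : (0 <= t)%R -> (t <= 1)%R -> C (p t).
  by move=> t0 t1; apply: sC; exists t => //=; rewrite in_itv/= t0 t1.
have pB s t : (p s - p t = (s - t) *: (x - y))%R.
  have pE r : (p r = y + r *: (x - y))%R.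
    by rewrite /p scalerBl scale1r scalerBr addrCA.
  by rewrite !pE opprD addrACA subrr add0r scalerBl.
have := @eq_of_increment_le R (fun t => G1 (p t) - G2 (p t))%R
  (fun t => ip (u (p t)) (x - y)%R).
rewrite /p scale1r subrr scale0r addr0 scale0r subr0 scale1r add0r; apply.
move=> s t t0 ts s1; rewrite -!/(p _).
have Ct := pC t t0 (le_trans ts s1); have Cs := pC s (le_trans t0 ts) s1.
have := sub1 _ _ Ct Cs; have := sub2 _ _ Ct Cs.
have := sub1 _ _ Cs Ct; have := sub2 _ _ Cs Ct.
rewrite !pB !dotZr ler_norml; set ms := ip _ _; set mt := ip _ _.
by move=> *; apply/andP; split; lra.
Qed.

(** Asking for the inequalities between points of [C] alone lets [G2] be an expression in [phi] and
    [f] for which minimality gives them just on [Y]. *)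
Lemma polygonal_eq_diff (C : set H) (u : H -> H) (G1 G2 : H -> \bar R) :
    polygonally_connected C ->
    (forall z, C z -> G1 z \is a fin_num) ->
    (forall z, C z -> G2 z \is a fin_num) ->
    (forall z z', C z -> C z' -> G1 z + (ip (u z) (z' - z)%R)%:E <= G1 z') ->
    (forall z z', C z -> C z' -> G2 z + (ip (u z) (z' - z)%R)%:E <= G2 z') ->
  exists K : R, forall x, C x -> G1 x = G2 x + K%:E.
Proof.
move=> [[x0 Cx0] conn] fin1 fin2 sub1 sub2.
have sub G : (forall z, C z -> G z \is a fin_num) ->
    (forall z z', C z -> C z' -> G z + (ip (u z) (z' - z)%R)%:E <= G z') ->
    forall z z', C z -> C z' ->
      (ip (u z) (z' - z) <= fine (G z') - fine (G z))%R.
  move=> fin subG z z' Cz Cz'; rewrite lerBrDl -lee_fin EFinD !fineK ?fin//.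
  exact: subG.
exists (fine (G1 x0) - fine (G2 x0))%R => x Cx.
suff -> : (fine (G1 x0) - fine (G2 x0) = fine (G1 x) - fine (G2 x))%R.
  by rewrite -[in RHS](fineK (fin2 _ Cx)) -EFinD subrKC fineK ?fin1.
have [n [p [<- <- pC]]] := conn _ _ Cx0 Cx.
have {}pC k : (k <= n)%N ->
    (fine (G1 (p 0%N)) - fine (G2 (p 0%N)) = fine (G1 (p k)) - fine (G2 (p k)))%R.
  elim: k => // k IH kn; rewrite IH 1?ltnW//.
  exact: (segment_eq_diff (G1 := fine \o G1) (G2 := fine \o G2) (pC _ kn)
    (sub _ fin1 sub1) (sub _ fin2 sub2)).
exact: pC.
Qed.

End InnerProduct.

(** * Minimality as a system of inequalities, for an abstract coupling [c] *)

Section PenalizedMinimization.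
Context (R : realType) (T U : Type) (Y : set U).
Context (a : U -> \bar R) (b : T -> \bar R) (c : T -> U -> R) (f : U -> T).
Hypotheses (a_noo : no_ninfty Y a) (b_noo : no_ninfty setT b).

(** Extracts what the converse directions of the equivalences draw from a finite cost at [f y]. *)
Lemma cost_fin_num x y : Y y -> a y - (c x y)%:E + b x < +oo ->
  a y \is a fin_num /\ b x \is a fin_num.
Proof.
move=> /a_noo; have := b_noo (I : setT x).
by case: (a y) => [ay| |]; case: (b x) => [bx| |].
Qed.

(** A minimizer has a value below [+oo] and no term is [-oo], so all terms at [f y] are finite and
    [a y] cancels. *)
Lemma minimizes_penalizedP phi :
  minimizes_penalized Y (fun x y => a y - (c x y)%:E + b x) f phi <->
  no_ninfty setT phi /\ forall y, Y y ->
    [/\ a y \is a fin_num, b (f y) \is a fin_num, phi (f y) \is a fin_num &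
        forall x, b (f y) + phi (f y) + (c x y - c (f y) y)%:E <= b x + phi x].
Proof.
split=> -[phi_noo phi_min]; split=> // y Yy; have := phi_min y Yy.
- move=> [/= fin_y min_y].
  have [/EFin_fin_numP[ay aE] /EFin_fin_numP[bfy bE] /EFin_fin_numP[pfy pE]] :
      [/\ a y \is a fin_num, b (f y) \is a fin_num & phi (f y) \is a fin_num].
    have := a_noo Yy; have := b_noo (I : setT (f y)); have := phi_noo (f y) I.
    move: fin_y; clear min_y.
    by case: (a y) => [?| |]; case: (b (f y)) => [?| |]; case: (phi (f y)) => [?| |].
  rewrite aE bE pE; split=> // x; have := min_y x; rewrite aE bE pE.
  have := b_noo (I : setT x); have := phi_noo x I.
  case: (b x) => // [bx|]; case: (phi x) => // [px|] _ _; rewrite ?leey//.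
  by rewrite !lee_fin; lra.
- move=> [/EFin_fin_numP[ay ->] /EFin_fin_numP[bfy bE] /EFin_fin_numP[pfy pE]].
  rewrite bE pE => min_y; split=> /=; rewrite bE pE ?ltry// => x.
  have := min_y x; have := b_noo (I : setT x); have := phi_noo x I.
  case: (b x) => // [bx|]; case: (phi x) => // [px|] _ _; rewrite ?leey//.
  by rewrite !lee_fin; lra.
Qed.

End PenalizedMinimization.

(** * The couplings through [A] (primal) and through [B] (dual) *)

Section PrimalDual.
Context (R : realType) (H H' : completeNormedModType R).
Context (ip : {dot H for @idfun R}) (ip' : {dot H' for @idfun R}).
Hypotheses (ip_norm : induces_norm ip) (ip'_norm : induces_norm ip').
Context (Y : set H') (Y_neq0 : Y !=set0).
Context (a : H' -> \bar R) (a_noo : no_ninfty Y a).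
Context (b : H -> \bar R) (b_noo : no_ninfty setT b).
Context (A : H' -> H) (B : H -> H') (f : H' -> H).

Let Imf := f @` Y.
Let D := fun (x : H) (y : H') => a y - (ip x (A y))%:E + b x.
Let D' := fun (x : H) (y : H') => a y - (ip' (B x) y)%:E + b x.

Definition primal_subgradient (g : H -> \bar R) :=
  convex_lsc g /\
  forall x, Imf x -> A @` (Y `&` f @^-1` [set x]) `<=` subdiff ip g x.

Definition dual_subgradient (psi : H' -> \bar R) :=
  convex_lsc psi /\ forall y, Y y -> subdiff ip' psi y (B (f y)).

Lemma primal_penaltyP phi : minimizes_penalized Y D f phi <->
  no_ninfty setT phi /\ forall y, Y y ->
    [/\ a y \is a fin_num, b (f y) \is a fin_num, phi (f y) \is a fin_num &
        forall x, b (f y) + phi (f y) + (ip (A y) (x - f y)%R)%:E <= b x + phi x].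
Proof.
rewrite (minimizes_penalizedP (fun x y => ip x (A y)) f a_noo b_noo).
split=> -[phi_noo phi_min]; split=> // y /phi_min[? ? ? min_y]; split=> // x;
  by have := min_y x; rewrite dotBr !(dot_sym ip (A y)).
Qed.

Lemma dual_penaltyP phi : minimizes_penalized Y D' f phi <->
  no_ninfty setT phi /\ forall y, Y y ->
    [/\ a y \is a fin_num, b (f y) \is a fin_num, phi (f y) \is a fin_num &
        forall x, b (f y) + phi (f y) + (ip' (B x) y - ip' (B (f y)) y)%:E <=
          b x + phi x].
Proof. exact: (minimizes_penalizedP (fun x y => ip' (B x) y) f a_noo b_noo). Qed.

Lemma subdiff_fin_num (K : completeNormedModType R) (k : {dot K for @idfun R})
    (h : K -> \bar R) x u :
  no_ninfty setT h -> subdiff k h x u -> h x \is a fin_num.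
Proof. by move=> h_noo [hx _]; rewrite fin_numElt hx h_noo. Qed.

(** Selects one subgradient [A (s x)] per image point for primal uniqueness, and one preimage per
    image point for the dual penalty. *)
Lemma image_section : exists s : H -> H', forall x, Imf x -> Y (s x) /\ f (s x) = x.
Proof.
have [y0 _] := Y_neq0.
suff /choice[s sP] : forall x, exists y, Imf x -> Y y /\ f y = x by exists s.
move=> x; have [[y Yy fy]|nx] := pselect (Imf x); first by exists y.
by exists y0.
Qed.

(** The given [phi] may be finite off the image, hence [chi] on both sides of the identity. *)
Lemma primal_subgradient_of_penalty phi : minimizes_penalized Y D f phi ->
  exists g, primal_subgradient g /\
    forall x, g x + chi Imf x = b x + phi x + chi Imf x.
Proof.
move=> /primal_penaltyP[phi_noo phi_min].
(* This constant makes the affine function of slope [A y] meet [b + phi] at [f y]. *)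
pose k y := (fine (b (f y) + phi (f y)) - ip (A y) (f y))%R.
have contact y : Y y -> affine_sup ip Y A k (f y) = b (f y) + phi (f y) /\
    subdiff ip (affine_sup ip Y A k) (f y) (A y).
  move=> Yy; have [_ fin_b fin_phi _] := phi_min y Yy.
  have -> : b (f y) + phi (f y) = (ip (A y) (f y) + k y)%:E.
    by rewrite /k subrKC fineK// fin_numD fin_b.
  apply: affine_sup_contact => // j Yj; have [_ fin_bj fin_phij min_j] := phi_min j Yj.
  have := min_j (f y); rewrite /k dotBr.
  move: fin_b fin_phi fin_bj fin_phij => /EFin_fin_numP[? ->] /EFin_fin_numP[? ->].
  by move=> /EFin_fin_numP[? ->] /EFin_fin_numP[? ->]; rewrite lee_fin /=; lra.
have g_convex := affine_sup_convex_lsc ip_norm A k Y_neq0.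
exists (affine_sup ip Y A k); split; first split=> //.
  by move=> x _ u [y [Yy /= <-] <-]; exact: (contact y Yy).2.
move=> x; rewrite /chi; case: ifPn => [/set_mem[y Yy <-]|_].
  by rewrite (contact y Yy).1.
have [g_noo _ _] := g_convex.
have := g_noo x I; have := b_noo (I : setT x); have := phi_noo x I.
by case: (b x) => [?| |]; case: (phi x) => [?| |]; case: (affine_sup _ _ _ _ x).
Qed.

Lemma penalty_of_primal_subgradient g :
    (forall y, Y y -> a y \is a fin_num /\ b (f y) \is a fin_num) ->
    primal_subgradient g ->
  exists phi, minimizes_penalized Y D f phi /\
    forall x, g x + chi Imf x = b x + phi x.
Proof.
move=> fin [[g_noo _ _] sub_g].
(* The value [+oo] rules out competitors off the image. *)
pose phi x := if x \in Imf then g x - b x else +oo.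
have sub y : Y y -> subdiff ip g (f y) (A y).
  by move=> Yy; apply: (sub_g (f y)); exists y.
have phiE x : g x + chi Imf x = b x + phi x.
  rewrite /chi /phi; case: ifPn => [/set_mem[y Yy <-]|_].
    by rewrite adde0 addeC subeK//; have [] := fin y Yy.
  by rewrite !addey// gt_eqF// ?g_noo// b_noo.
have f_Imf y : Y y -> f y \in Imf by move=> Yy; apply/mem_set; exists y.
have gE y : Y y -> g (f y) = b (f y) + phi (f y).
  by move=> Yy; rewrite -phiE /chi f_Imf// adde0.
exists phi; split=> //; apply/primal_penaltyP; split=> [x _|y Yy].
  rewrite /phi; case: ifPn => // /set_mem[y Yy <-].
  have [_ fin_b] := fin y Yy; have fin_g := subdiff_fin_num g_noo (sub y Yy).
  have : g (f y) - b (f y) \is a fin_num by rewrite fin_numB fin_g.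
  by rewrite fin_numElt => /andP[].
have [fin_a fin_b] := fin y Yy.
have fin_g := subdiff_fin_num g_noo (sub y Yy).
split=> // [|x]; first by rewrite /phi f_Imf// fin_numB fin_g.
(* Since [b + phi] is [g] plus the nonnegative [chi], it inherits the subgradient inequality of [g]
   at [f y]. *)
rewrite -gE// -phiE; apply: le_trans ((sub y Yy).2 x) _.
by rewrite leeDl// /chi; case: ifP; rewrite ?leey.
Qed.

Lemma primal_uniqueness phi g (C : set H) :
    minimizes_penalized Y D f phi -> primal_subgradient g ->
    C `<=` Imf -> polygonally_connected C ->
  exists K : R, forall x, C x -> g x = b x + phi x + K%:E.
Proof.
move=> /primal_penaltyP[phi_noo phi_min] [[g_noo _ _] sub_g] CI conn.
have [s sP] := image_section.
have sub z : C z -> subdiff ip g z (A (s z)).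
  by move=> /CI Iz; have [Ys fs] := sP z Iz; apply: sub_g => //; exists (s z).
apply: (polygonal_eq_diff (ip := ip) (u := A \o s) conn).
- by move=> z /sub; exact: subdiff_fin_num.
- by move=> z /CI/sP[Ys <-]; have [_ fin_b fin_phi _] := phi_min _ Ys;
    rewrite fin_numD fin_b.
- by move=> z z' /sub[_ +] _; apply.
- move=> z z' /CI/sP[Ys fs] _; have [_ _ _ +] := phi_min _ Ys.
  by move=> /(_ z'); rewrite fs.
Qed.

Lemma dual_subgradient_of_penalty phi : minimizes_penalized Y D' f phi ->
  exists psi, dual_subgradient psi /\
    forall y, Y y -> psi y = (ip' (B (f y)) y)%:E - b (f y) - phi (f y).
Proof.
move=> /dual_penaltyP[phi_noo phi_min].
pose k y := (- fine (b (f y) + phi (f y)))%R.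
have contact y : Y y -> affine_sup ip' Y (B \o f) k y =
      (ip' (B (f y)) y)%:E - b (f y) - phi (f y) /\
    subdiff ip' (affine_sup ip' Y (B \o f) k) y (B (f y)).
  move=> Yy; have [_ fin_b fin_phi _] := phi_min y Yy.
  have -> : (ip' (B (f y)) y)%:E - b (f y) - phi (f y) =
      (ip' ((B \o f) y) y + k y)%:E.
    move: fin_b fin_phi; rewrite /k => /EFin_fin_numP[? ->] /EFin_fin_numP[? ->].
    by rewrite /= opprD addrA.
  apply: affine_sup_contact => // j Yj; have [_ fin_bj fin_phij _] := phi_min j Yj.
  (* Minimality at [y] against the competitor [f j] says that index [y] beats index [j] at the point
     [y]. *)
  have [_ _ _ /(_ (f j))] := phi_min y Yy.
  rewrite /k /=.
  move: fin_b fin_phi fin_bj fin_phij => /EFin_fin_numP[? ->] /EFin_fin_numP[? ->].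
  by move=> /EFin_fin_numP[? ->] /EFin_fin_numP[? ->]; rewrite lee_fin /=; lra.
exists (affine_sup ip' Y (B \o f) k); split; last by move=> y /contact[].
by split=> [|y /contact[]//]; exact: affine_sup_convex_lsc.
Qed.

Lemma penalty_of_dual_subgradient psi :
    (forall y, Y y -> a y \is a fin_num /\ b (f y) \is a fin_num) ->
    dual_subgradient psi ->
  exists phi, minimizes_penalized Y D' f phi /\
    forall y, Y y -> psi y = (ip' (B (f y)) y)%:E - b (f y) - phi (f y).
Proof.
move=> fin [[psi_noo _ _] sub].
have fin_psi y : Y y -> psi y \is a fin_num.
  by move=> /sub; exact: subdiff_fin_num.
have [s sP] := image_section.
(* The required identity is solved for [phi]; as [phi] sees [x] alone, a preimage [s x] stands in
   for [y]. *)
pose phi x := if x \in Imf then (ip' (B x) (s x))%:E - b x - psi (s x) else +oo.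
(* Each subgradient inequality is used both ways: if [f y = f y'], then [psi] and
   [<B (f y), .>] differ by the same constant at [y] and [y'], so the choice of [s] is
   immaterial. *)
have phiE y : Y y -> phi (f y) = (ip' (B (f y)) y)%:E - b (f y) - psi y.
  move=> Yy; have If : Imf (f y) by exists y.
  rewrite /phi mem_set//; have [Ys fs] := sP _ If.
  have [_ /(_ (s (f y)))] := sub y Yy; have [_ /(_ y)] := sub _ Ys.
  rewrite fs !dotBr; have [_] := fin y Yy; have := fin_psi _ Yy; have := fin_psi _ Ys.
  move=> /EFin_fin_numP[? ->] /EFin_fin_numP[? ->] /EFin_fin_numP[? ->].
  by rewrite !lee_fin => ? ?; congr EFin; lra.
exists phi; split; last first.
  move=> y Yy; rewrite phiE//; have [_] := fin y Yy; have := fin_psi _ Yy.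
  by move=> /EFin_fin_numP[? ->] /EFin_fin_numP[? ->]; congr EFin; ring.
apply/dual_penaltyP; split=> [x _|y Yy].
  have [If|If] := pselect (Imf x); last by rewrite /phi memNset.
  have [y Yy <-] := If; rewrite phiE//; have [_] := fin y Yy; have := fin_psi _ Yy.
  by move=> /EFin_fin_numP[? ->] /EFin_fin_numP[? ->]; exact: ltNyr.
have [fin_a fin_b] := fin y Yy; split=> // [|x].
  by rewrite phiE// !fin_numB fin_b fin_psi.
have [[y' Yy' <-]|Ix] := pselect (Imf x); last first.
  by rewrite [phi x]/phi memNset// addey ?leey// gt_eqF// b_noo.
(* The subgradient inequality at [y'], tested at [y], is minimality at [y] against [f y']. *)
rewrite !phiE//; have [_ /(_ y)] := sub y' Yy'; have [_] := fin y' Yy'.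
rewrite dotBr; move: fin_b (fin_psi _ Yy) (fin_psi _ Yy').
move=> /EFin_fin_numP[? ->] /EFin_fin_numP[? ->] /EFin_fin_numP[? ->].
by move=> /EFin_fin_numP[? ->]; rewrite !lee_fin; lra.
Qed.

Lemma dual_uniqueness phi psi (C : set H') :
    minimizes_penalized Y D' f phi -> dual_subgradient psi ->
    C `<=` Y -> polygonally_connected C ->
  exists K : R, forall y, C y ->
    psi y = (ip' (B (f y)) y)%:E - b (f y) - phi (f y) + K%:E.
Proof.
move=> /dual_penaltyP[phi_noo phi_min] [[psi_noo _ _] sub] CY conn.
apply: (polygonal_eq_diff (ip := ip') (u := B \o f)
  (G2 := fun y => (ip' (B (f y)) y)%:E - b (f y) - phi (f y)) conn).
- by move=> z /CY/sub; exact: subdiff_fin_num.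
- by move=> z /CY/phi_min[_ fin_b fin_phi _]; rewrite !fin_numB fin_b fin_phi.
- by move=> z z' /CY/sub[_ +] _; apply.
(* The roles swap: the subgradient inequality at [z] comes from minimality at [z'] against [f z]. *)
- move=> z z' /CY/phi_min[_ fin_b fin_phi _] /CY/phi_min[_ fin_b' fin_phi' /(_ (f z))].
  rewrite /= dotBr; move: fin_b fin_phi fin_b' fin_phi'.
  move=> /EFin_fin_numP[? ->] /EFin_fin_numP[? ->].
  by move=> /EFin_fin_numP[? ->] /EFin_fin_numP[? ->]; rewrite !lee_fin; lra.
Qed.

End PrimalDual.

Theorem theorem3 (R : realType) (H H' : completeNormedModType R)
    (ip : {dot H for @idfun R}) (ip' : {dot H' for @idfun R})
    (ip_norm : induces_norm ip) (ip'_norm : induces_norm ip')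
    (Y : set H') (Y_neq0 : Y !=set0)
    (a : H' -> \bar R) (a_noo : no_ninfty Y a)
    (b : H -> \bar R) (b_noo : no_ninfty setT b)
    (A : H' -> H) (B : H -> H') (f : H' -> H) :
  let Imf := f @` Y in
  let D := fun (x : H) (y : H') => a y - (ip x (A y))%:E + b x in
  let D' := fun (x : H) (y : H') => a y - (ip' (B x) y)%:E + b x in
  let ai := fun phi : H -> \bar R => minimizes_penalized Y D f phi in
  let aii := fun g : H -> \bar R =>
    convex_lsc g /\
    forall x, Imf x -> A @` (Y `&` f @^-1` [set x]) `<=` subdiff ip g x in
  let ci := fun phi : H -> \bar R => minimizes_penalized Y D' f phi in
  let cii := fun psi : H' -> \bar R =>
    convex_lsc psi /\ forall y, Y y -> subdiff ip' psi y (B (f y)) in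
  (* (a) *)
  [/\ (forall y, Y y -> D (f y) y < +oo) ->
        ((exists phi, ai phi) <-> (exists g, aii g)),
      forall phi, ai phi ->
        exists g, aii g /\
          forall x, g x + chi Imf x = b x + phi x + chi Imf x &
      (exists phi, ai phi) ->
        forall g, aii g ->
          exists phi, ai phi /\ forall x, g x + chi Imf x = b x + phi x] /\
  (* (b) *)
  (forall (phi g : H -> \bar R) (C : set H),
     ai phi -> aii g -> C `<=` Imf -> polygonally_connected C ->
     exists K : R, forall x, C x -> g x = b x + phi x + K%:E) /\
  (* (c) *)
  [/\ (forall y, Y y -> D' (f y) y < +oo) ->
        ((exists phi, ci phi) <-> (exists psi, cii psi)),
      forall phi, ci phi ->
        exists psi, cii psi /\
          forall y, Y y ->
            psi y = (ip' (B (f y)) y)%:E - b (f y) - phi (f y) &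
      (exists phi, ci phi) ->
        forall psi, cii psi ->
          exists phi, ci phi /\
            forall y, Y y ->
              psi y = (ip' (B (f y)) y)%:E - b (f y) - phi (f y)] /\
  (* (d) *)
  (forall (phi : H -> \bar R) (psi : H' -> \bar R) (C' : set H'),
     ci phi -> cii psi -> C' `<=` Y -> polygonally_connected C' ->
     exists K' : R, forall y, C' y ->
       psi y = (ip' (B (f y)) y)%:E - b (f y) - phi (f y) + K'%:E).
Proof.
move=> Imf D D' ai aii ci cii.
(* One minimizing penalty already yields the finiteness needed to build another from any given
   [g]. *)
have fin_of_ai phi : ai phi ->
    forall y, Y y -> a y \is a fin_num /\ b (f y) \is a fin_num.
  by move=> /(primal_penaltyP ip a_noo b_noo)[_ + y Yy] => /(_ y Yy)[].
have fin_of_ci phi : ci phi ->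
    forall y, Y y -> a y \is a fin_num /\ b (f y) \is a fin_num.
  by move=> /(dual_penaltyP ip' a_noo b_noo)[_ + y Yy] => /(_ y Yy)[].
split; [|split; [|split]].
- split.
  + move=> finD; split=> [[phi /(primal_subgradient_of_penalty ip_norm Y_neq0 a_noo b_noo)]|].
      by move=> [g [g_sub _]]; exists g.
    move=> [g /(penalty_of_primal_subgradient a_noo b_noo)].
    case=> [y Yy|phi [phi_min _]]; last by exists phi.
    exact: (cost_fin_num (c := fun x y => ip x (A y)) a_noo b_noo Yy (finD y Yy)).
  + exact: primal_subgradient_of_penalty.
  + move=> [phi0 /fin_of_ai fin] g; exact: penalty_of_primal_subgradient.
- move=> phi g C; exact: primal_uniqueness.
- split.
  + move=> finD; split=> [[phi /(dual_subgradient_of_penalty ip'_norm Y_neq0 a_noo b_noo)]|].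
      by move=> [psi [psi_sub _]]; exists psi.
    move=> [psi /(penalty_of_dual_subgradient Y_neq0 a_noo b_noo)].
    case=> [y Yy|phi [phi_min _]]; last by exists phi.
    exact: (cost_fin_num (c := fun x y => ip' (B x) y) a_noo b_noo Yy (finD y Yy)).
  + exact: dual_subgradient_of_penalty.
  + move=> [phi0 /fin_of_ci fin] psi; exact: penalty_of_dual_subgradient.
- move=> phi psi C; exact: dual_uniqueness.
Qed.
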